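(* Let $\eta \in [0,2\pi)$ and let $G$ be a mixed complete graph on $n$ vertices equipped with its $\eta$-function $\theta$. If $n \geq 4$, then $G$ is not periodic.
   Context: A mixed graph $G=(V,\mathcal{A})$ consists of a finite vertex set $V$ and a subset $\mathcal{A} \subset V\times V \setminus \{(x,x) \mid x\in V\}$ of arcs. For an arc $a=(x,y)$, write $o(a)=x$, $t(a)=y$, $a^{-1}=(y,x)$. Let $\mathcal{A}^{-1}=\{a^{-1} \mid a\in\mathcal{A}\}$ and $\mathcal{A}^{\pm}=\mathcal{A}\cup\mathcal{A}^{-1}$. The underlying graph $G^{\pm}=(V,\mathcal{A}^{\pm})$ is regarded as an undirected simple graph, and $\deg_G x=\deg_{G^{\pm}}x$. A mixed complete graph is a mixed graph $G$ such that $G^{\pm}$ is isomorphic to a complete graph. The $\eta$-function $\theta:\mathcal{A}^{\pm}\to\mathbb{R}$ of $G$ is defined by $\theta(a)=\eta$ if $a\in\mathcal{A}\setminus\mathcal{A}^{-1}$, $\theta(a)=-\eta$ if $a\in\mathcal{A}^{-1}\setminus\mathcal{A}$, and $\theta(a)=0$ if $a\in\mathcal{A}\cap\mathcal{A}^{-1}$. Define $K\in\mathbb{C}^{V\times\mathcal{A}^{\pm}}$ by $K_{x,a}=\frac{1}{\sqrt{\deg_G x}}\delta_{x,t(a)}$, $C=2K^*K-I$, $(S_\theta)_{a,b}=e^{\theta(b)i}\delta_{a,b^{-1}}$ for $a,b\in\mathcal{A}^{\pm}$, and the time evolution matrix $U_\theta=S_\theta C\in\mathbb{C}^{\mathcal{A}^{\pm}\times\mathcal{A}^{\pm}}$.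 The mixed graph $G$ (equipped with $\theta$) is periodic if there is a positive integer $\tau$ with $U_\theta^{\tau}=I$. *)

(* Defs.v *)
From mathcomp Require Import all_boot all_order all_algebra.
From mathcomp Require Import complex.
From mathcomp Require Import reals trigo.

Set Implicit Arguments.
Unset Strict Implicit.
Unset Printing Implicit Defensive.

Import GRing.Theory Num.Theory.

Local Open Scope ring_scope.
Local Open Scope complex_scope.
Local Open Scope sesquilinear_scope.

Section MixedGraphs.
Variable V : finType.

Record mixed_graph := MixedGraph {
  arcs : {set V * V};
  arcs_loopless : forall x : V, (x, x) \notin arcs
}.

Definition arc_inv (a : V * V) : V * V := (a.2, a.1).

Variable G : mixed_graph.

Definition arcs_inv : {set V * V} := [set arc_inv a | a in arcs G].
Definition arcs_pm : {set V * V} := arcs G :|: arcs_inv.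

Definition adj : rel V := fun x y => (x, y) \in arcs_pm.

Definition deg (x : V) : nat := #|[set y | adj x y]|.

(* The index set of the time evolution matrix. *)
Definition darc : finType := {a : V * V | a \in arcs_pm}.

End MixedGraphs.

Definition graph_iso (T T' : finType) (e : rel T) (e' : rel T') : Prop :=
  exists2 f : T -> T', bijective f & forall x y, e' (f x) (f y) = e x y.

Definition complete_rel (m : nat) : rel 'I_m := fun i j => i != j.

Definition mixed_complete (V : finType) (G : mixed_graph V) : Prop :=
  exists m : nat, graph_iso (adj G) (@complete_rel m).

Section Walk.
Variables (R : realType) (V : finType) (G : mixed_graph V).

(* Every element of darc G lies in arcs G or in arcs_inv G, so the last branch
   is the case where it lies in both. *)
Definition eta_function (eta : R) (a : darc G) : R :=
  if val a \in arcs G :\: arcs_inv G then eta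
  else if val a \in arcs_inv G :\: arcs G then - eta
  else 0.

Definition expi (t : R) : R[i] := cos t +i* sin t.

(* Rows and columns indexed by a finite type T are numbered by 'I_#|T|
   through enum_val. *)
Definition boundary_mx : 'M[R[i]]_(#|V|, #|darc G|) :=
  \matrix_(x, a)
    (((Num.sqrt (deg G (enum_val x))%:R)^-1)%:C
     * (enum_val x == (val (enum_val a)).2)%:R).

Definition coin_mx : 'M[R[i]]_#|darc G| :=
  2%:R *: (boundary_mx^t* *m boundary_mx) - 1%:M.

Definition shift_mx (theta : darc G -> R) : 'M[R[i]]_#|darc G| :=
  \matrix_(a, b)
    (expi (theta (enum_val b))
     * (val (enum_val a) == arc_inv (val (enum_val b)))%:R).

Definition time_evolution_mx (theta : darc G -> R) : 'M[R[i]]_#|darc G| :=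
  shift_mx theta *m coin_mx.

Definition walk_periodic (theta : darc G -> R) : Prop :=
  exists2 tau : nat, (0 < tau)%N & time_evolution_mx theta ^+ tau = 1%:M.

End Walk.

(* Main.v *)
Require Import Defs.
From mathcomp Require Import all_boot all_order all_algebra all_field.
From mathcomp Require Import complex ring zify.
From mathcomp Require Import reals trigo.

(** If [U ^+ tau = 1], then [U] is diagonalizable and its eigenvalues are
    roots of unity, hence algebraic integers. So is every symmetric function of
    them with integer coefficients; here the second elementary one is enough,
    [e = ((\tr U) ^+ 2 - \tr (U *m U)) / 2] ([integral_trace_gap]).

    On a k-regular graph both traces can be read off the entries of [U]
    ([time_evolutionE]): [U a b] is nonzero only if [b] ends where [a] starts.
    No arc has this relation to itself, so [\tr U = 0]; and [a], [b] have it to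
    each other only if they are mutually inverse, in which case the two phases
    cancel and [U a b * U b a = (2 / k - 1) ^+ 2]. Thus the phases disappear and
    [\tr (U *m U)] is this square times the number of arcs.

    For [n = m + 1] vertices in a complete graph, with [m (m + 1)] arcs and
    [k = m], this gives [e = - (m + 1) (m - 2) ^+ 2 / (2 m)]. A rational
    algebraic integer is an integer ([rational_algebraic_integer]), and this
    number is not an integer when [m >= 3] ([trace_gap_not_int]). *)

Set Implicit Arguments.
Unset Strict Implicit.
Unset Printing Implicit Defensive.

Import GRing.Theory Num.Theory.

Local Open Scope ring_scope.

Notation algebraic_integer := (integralOver intr).

(** * Matrices of finite order and algebraic integers *)

(** In characteristic 0 the polynomial ['X^tau - 1], which kills [A], splits
    with simple roots; hence so does the minimal polynomial of [A]. *)
Lemma finite_order_diagonalizable (C : numClosedFieldType) (n tau : nat)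
    (A : 'M[C]_n) :
  (0 < tau)%N -> A ^+ tau = 1%:M ->
  exists P : 'M[C]_n, exists d : 'rV[C]_n,
    [/\ P \in unitmx, P *m A = diag_mx d *m P & forall i, d 0 i ^+ tau = 1].
Proof.
move=> tau_gt0; case: n A => [|n] A Atau.
  exists 1%:M; exists 0.
  by split=> [||[]//]; rewrite ?unitmx1 // thinmx0 [RHS]thinmx0.
have [rs def_rs] := closed_field_poly_normal ('X^tau - 1 : {poly C}).
rewrite lead_coefXnsubC // scale1r in def_rs.
have tau0 : tau%:R != 0 :> C by rewrite pnatr_eq0 -lt0n.
have uniq_rs : uniq rs.
  by rewrite -separable_prod_XsubC -def_rs separable_Xn_sub_1.
have [P Punit /similar_diagPex[d /(similarP Punit) PA]] :
    exists2 P : 'M[C]_n.+1, P \in unitmx & similar_diag P A.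
  apply/diagonalizableP; exists rs => //; rewrite -def_rs.
  apply: mxminpoly_min.
  by rewrite rmorphB rmorphXn /= horner_mx_X rmorph1 Atau subrr.
exists P; exists d; split=> // i.
have PAk k : P *m A ^+ k = diag_mx d ^+ k *m P.
  elim: k => [|k IHk]; first by rewrite !expr0 mul1mx mulmx1.
  by rewrite exprS mulmxA PA -mulmxA IHk mulmxA exprS.
have dk k : (diag_mx d ^+ k) i i = d 0 i ^+ k.
  elim: k => [|k IHk]; first by rewrite !expr0 mxE eqxx.
  by rewrite !exprS -IHk -mulmxE mul_diag_mx mxE.
rewrite -dk.
have /(congr1 (mulmxr (invmx P))) := PAk tau.
by rewrite Atau mulmx1 /= mulmxK // mulmxV // => <-; rewrite mxE eqxx.
Qed.

Lemma unity_root_integral (K : fieldType) (tau : nat) (z : K) :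
  (0 < tau)%N -> z ^+ tau = 1 -> algebraic_integer z.
Proof.
move=> tau_gt0 z_tau; exists ('X^tau - 1); first exact: monicXnsubC.
by rewrite /root rmorphB rmorph1 /= map_polyXn !hornerE z_tau subrr.
Qed.

(** The witness [e] is the sum of the products of two entries at distinct
    positions, that is, their second elementary symmetric function. *)
Lemma integral_pair_sum (K : fieldType) (I : Type) (s : seq I) (d : I -> K) :
  (forall i, algebraic_integer (d i)) ->
  exists2 e, algebraic_integer e &
    (\sum_(i <- s) d i) ^+ 2 = \sum_(i <- s) d i ^+ 2 + 2%:R * e.
Proof.
move=> d_int.
suff [e [e_int _ De]] : exists e, [/\ algebraic_integer e,
    algebraic_integer (\sum_(i <- s) d i) &
    (\sum_(i <- s) d i) ^+ 2 = \sum_(i <- s) d i ^+ 2 + 2%:R * e].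
  by exists e.
elim: s => [|i s [e [e_int s_int De]]].
  exists 0; rewrite !big_nil mulr0 addr0 expr0n; split=> //; exact: integral0.
exists (e + d i * \sum_(j <- s) d j); rewrite !big_cons; split.
- by apply: integral_add => //; apply: integral_mul.
- exact: integral_add.
by rewrite sqrrD De; ring.
Qed.

(** Up to sign, [e] is the third highest coefficient of the characteristic
    polynomial of [A]; what the lemma adds is that the division by 2 in
    [((\tr A) ^+ 2 - \tr (A *m A)) / 2] does not destroy integrality. *)
Lemma integral_trace_gap (C : numClosedFieldType) (n tau : nat) (A : 'M[C]_n) :
  (0 < tau)%N -> A ^+ tau = 1%:M ->
  exists2 e, algebraic_integer e & \tr A ^+ 2 = \tr (A *m A) + 2%:R * e.
Proof.
move=> tau_gt0 /(finite_order_diagonalizable tau_gt0)[P [d [Pu PA dtau]]].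
have [|e e_int De] := integral_pair_sum (index_enum 'I_n) (d := d 0).
  by move=> i; apply: unity_root_integral tau_gt0 (dtau i).
exists e => //.
have trPK (B : 'M[C]_n) : \tr (P *m B *m invmx P) = \tr B.
  by rewrite mxtrace_mulC mulmxA mulVmx // mul1mx.
rewrite -(trPK A) -(trPK (A *m A)) !mulmxA PA mulmxK // mxtrace_diag De.
rewrite -(mulmxA (diag_mx d) P A) PA !mulmxA mulmxK // mulmx_diag mxtrace_diag.
by congr (_ + _); apply: eq_bigr => i _; rewrite mxE expr2.
Qed.

(** The integer polynomial that makes [q] integral has [q] as a root in any
    field of characteristic 0, so the known result on algebraic integers in
    [algC] applies. *)
Lemma rational_algebraic_integer (K : numFieldType) (q : rat) :
  algebraic_integer (ratr q : K) -> q \is a Num.int.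
Proof.
case=> p p_monic.
have -> : map_poly intr p = map_poly ratr (map_poly intr p : {poly rat})
            :> {poly K}.
  by rewrite -map_poly_comp; apply: eq_map_poly => z /=; rewrite ratr_int.
rewrite fmorph_root => p_q.
have : (ratr q : algC) \is a Num.int.
  apply: Cint_rat_Aint; first exact: Crat_rat.
  apply: (@root_monic_Aint (map_poly intr p)).
  - rewrite -(fmorph_root (ratr : rat -> algC)) -map_poly_comp in p_q.
    by congr (root _ _): p_q; apply: eq_map_poly => z /=; rewrite ratr_int.
  - by rewrite monic_map.
  - by apply/polyOverP => i; rewrite coef_map intr_int.
case/intrP=> z /eqP.
by rewrite -(ratr_int _ z) fmorph_eq => /eqP->; apply: intr_int.
Qed.

(** * Arcs and their inverses *)

Section Walk.
Local Open Scope complex_scope.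
Variables (R : realType) (V : finType) (G : mixed_graph V).
Local Notation C := (R[i]).

Lemma arc_invK : involutive (@arc_inv V).
Proof. by case. Qed.

Lemma mem_arcs_inv (a : V * V) : (a \in arcs_inv G) = (arc_inv a \in arcs G).
Proof. by rewrite -[in LHS](arc_invK a) (mem_imset _ _ (can_inj arc_invK)). Qed.

Lemma arc_inv_pm (a : V * V) : (arc_inv a \in arcs_pm G) = (a \in arcs_pm G).
Proof. by rewrite !in_setU !mem_arcs_inv arc_invK orbC. Qed.

Lemma arcs_pm_loopless (x : V) : (x, x) \notin arcs_pm G.
Proof. by rewrite in_setU mem_arcs_inv orbb arcs_loopless. Qed.

Definition darc_inv (a : darc G) : darc G :=
  exist _ (arc_inv (val a)) (etrans (arc_inv_pm (val a)) (valP a)).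

Lemma darc_invK : involutive darc_inv.
Proof. by move=> a; apply: val_inj; rewrite /= arc_invK. Qed.

Lemma darc_loopless (a : darc G) : (val a).1 == (val a).2 = false.
Proof.
apply/eqP=> a12; have := valP a.
by rewrite [val a]surjective_pairing a12 (negPf (arcs_pm_loopless _)).
Qed.

Lemma darc_inv_neq (a : darc G) : darc_inv a == a = false.
Proof.
apply/eqP=> /(congr1 (fun b => (val b).1)) /= a21.
by have := darc_loopless a; rewrite -a21 eqxx.
Qed.

Lemma eta_functionN (eta : R) (a : darc G) :
  eta_function eta (darc_inv a) = - eta_function eta a.
Proof.
rewrite /eta_function /= !in_setD !mem_arcs_inv arc_invK.
by do 2![case: (_ \in _)] => /=; rewrite ?opprK ?oppr0.
Qed.

(** * Traces of the time evolution matrix *)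

Lemma expiD (s t : R) : expi (s + t) = expi s * expi t.
Proof. by rewrite /expi cosD sinD; simpc; rewrite [cos s * sin t + _]addrC. Qed.

Lemma expi0 : expi 0 = 1 :> C.
Proof. by rewrite /expi cos0 sin0. Qed.

Lemma sum_enum_rank (T : finType) (F : 'I_#|T| -> C) :
  \sum_i F i = \sum_x F (enum_rank x).
Proof.
by apply: reindex; exists enum_val => x _; rewrite ?enum_rankK ?enum_valK.
Qed.

(** Row [a] of the shift matrix is supported on the inverse of [a], which ends
    where [a] starts, so the entry is a coin entry at that inverse arc, up to a
    phase. *)
Lemma time_evolutionE (theta : darc G -> R) (a b : darc G) :
  time_evolution_mx theta (enum_rank a) (enum_rank b) =
  expi (theta (darc_inv a)) *
    (2%:R / (deg G (val a).1)%:R * ((val a).1 == (val b).2)%:R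
     - (darc_inv a == b)%:R).
Proof.
rewrite mxE (bigD1 (enum_rank (darc_inv a))) //= big1 ?addr0 => [|j].
  rewrite !mxE !enum_rankK /= arc_invK eqxx mulr1 (inj_eq enum_rank_inj).
  congr (_ * (_ - _)).
  rewrite -mulrA; congr (_ * _).
  rewrite (bigD1 (enum_rank (val a).1)) //= big1 ?addr0 => [|x].
    rewrite !mxE !enum_rankK /= eqxx mulr1 mulrA; congr (_ * _).
    rewrite [X in X * _](conjc_real _) -rmorphM /= -invfM -expr2.
    by rewrite sqr_sqrtr ?ler0n // fmorphV rmorph_nat.
  rewrite !mxE !enum_rankK /= -(inj_eq enum_val_inj) enum_rankK => /negPf->.
  by rewrite mulr0 rmorph0 mul0r.
rewrite -(inj_eq enum_val_inj) enum_rankK => ja; rewrite mxE enum_rankK.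
suff /negPf-> : val a != arc_inv (val (enum_val j)) by rewrite mulr0 mul0r.
by apply: contra ja => /eqP aj; rewrite -val_eqE /= aj arc_invK.
Qed.

Lemma trace_time_evolution (theta : darc G -> R) :
  \tr (time_evolution_mx theta) = 0.
Proof.
rewrite /mxtrace sum_enum_rank big1 // => a _.
by rewrite time_evolutionE darc_loopless darc_inv_neq mulr0 subrr mulr0.
Qed.

(** A closed two-step path of the walk must go from [a] to its inverse and
    back; its phase is trivial because [theta] is odd. *)
Lemma trace_time_evolution_sq (theta : darc G -> R) (k : nat) :
  (forall a, theta (darc_inv a) = - theta a) -> (forall x, deg G x = k) ->
  \tr (time_evolution_mx theta *m time_evolution_mx theta) =
  #|darc G|%:R * (2%:R / k%:R - 1) ^+ 2.
Proof.
move=> thetaN degk; rewrite /mxtrace sum_enum_rank mulr_natl -sumr_const.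
apply: eq_bigr => a _; rewrite mxE sum_enum_rank (bigD1 (darc_inv a)) //=.
rewrite big1 ?addr0 => [|b /negPf ba].
  rewrite !time_evolutionE darc_invK /= !degk !eqxx !mulr1 mulrACA -expiD.
  by rewrite thetaN addNr expi0 mul1r expr2.
have inv_ab : darc_inv a == b = false by rewrite eq_sym.
have inv_ba : darc_inv b == a = false.
  by apply: contraFF ba => /eqP<-; rewrite darc_invK.
rewrite !time_evolutionE !degk inv_ab inv_ba.
rewrite !subr0 mulrACA [X in _ * X]mulrACA -natrM mulnb.
suff -> : ((val a).1 == (val b).2) && ((val b).1 == (val a).2) = false.
  by rewrite !mulr0.
apply: contraFF ba => /andP[/eqP ab /eqP ba].
by rewrite -val_eqE /= /arc_inv ab -ba -surjective_pairing.
Qed.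

(** * Mixed complete graphs *)

Lemma mixed_complete_adj :
  mixed_complete G -> forall x y, adj G x y = (x != y).
Proof.
by case=> m [f f_bij f_adj] x y; rewrite -f_adj /complete_rel (bij_eq f_bij).
Qed.

Lemma deg_complete x :
  (forall x y, adj G x y = (x != y)) -> deg G x = #|V|.-1.
Proof.
move=> cG; rewrite -cardsT (cardsD1 x) inE /= /deg; apply: eq_card => y.
by rewrite !inE /= cG eq_sym andbT.
Qed.

Lemma card_darc_complete :
  (forall x y, adj G x y = (x != y)) -> #|darc G| = (#|V| * #|V|.-1)%N.
Proof.
move=> cG; rewrite card_sig -sum1_card.
rewrite (eq_bigl (fun a => (true && (adj G a.1 a.2)))); last by case.
rewrite -(pair_big_dep xpredT (adj G) (fun _ _ => 1%N)) /= -sum_nat_const.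
apply: eq_bigr => x _; rewrite -(deg_complete x cG) sum1_card /deg.
by apply: eq_card => y; rewrite !inE.
Qed.

End Walk.

(** Since [(m + 1) * (m - 2) ^+ 2 = m * (m ^+ 2 - 3 * m) + 4], equality would
    make [m] a divisor of 4, hence [m = 4] and [8 * q = - 20]. *)
Lemma trace_gap_not_int (m : nat) (q : int) :
  (3 <= m)%N -> 2 * m%:R * q <> - ((m%:R + 1) * (m%:R - 2) ^+ 2).
Proof.
rewrite natz => m3 E.
have d4 : (m%:Z %| 4)%Z.
  apply/dvdzP; exists (- (2 * q + m%:Z ^+ 2 - 3 * m%:Z)); nia.
have m_le4 : (m <= 4)%N by have := dvdn_leq (isT : (0 < 4)%N) d4.
have {m_le4} m34 : (m == 3) || (m == 4) by lia.
by case/orP: m34 E d4 => /eqP-> E //; lia.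
Qed.

Theorem theorem1p1 (R : realType) (eta : R) (V : finType) (n : nat)
    (G : mixed_graph V) :
  0 <= eta -> eta < 2%:R * pi ->
  mixed_complete G -> #|V| = n -> (4 <= n)%N ->
  ~ walk_periodic (eta_function (G := G) eta).
Proof.
move=> _ _ /mixed_complete_adj cG Vn n_ge4 [tau tau_gt0 Utau].
have [e e_int] := integral_trace_gap tau_gt0 Utau.
rewrite trace_time_evolution (trace_time_evolution_sq (k := n.-1)); first last.
- by move=> x; rewrite deg_complete ?Vn.
- exact: eta_functionN.
rewrite card_darc_complete // Vn; case: n n_ge4 {Vn} => // m m_ge3 /= De.
pose q : rat := - ((m%:R + 1) * (m%:R - 2) ^+ 2) / (2 * m%:R).
have eq_e : e = ratr q.
  have m0 : m%:R != 0 :> R[i] by rewrite pnatr_eq0; lia.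
  have two0 : 2%:R != 0 :> R[i] by rewrite pnatr_eq0.
  rewrite /q fmorph_div rmorphN !rmorphM rmorphD rmorphB /= !rmorph_nat rmorph1.
  apply: (mulfI two0).
  move/eqP: De; rewrite expr0n /= eq_sym addrC addr_eq0 => /eqP->.
  by rewrite natrM -natr1; field; rewrite m0.
rewrite eq_e in e_int.
have /rational_algebraic_integer/intrP[z Dz] := e_int.
have m0 : m%:R != 0 :> rat by rewrite pnatr_eq0; lia.
apply: (@trace_gap_not_int m z) => //; apply: (@intr_inj rat).
rewrite !(rmorphM, rmorphN, rmorphXn, rmorphB, rmorphD) /= rmorph_nat -Dz /q.
by field.
Qed.
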